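(* Let $N\in{}^{*}\mathbb{N}\setminus\mathbb{N}$, let $\Omega={}^{*}[0,1]$, and let $\lambda$ be Lebesgue measure on $[0,1]$. Let $\mathcal{F}$ be the internal algebra on $\Omega$ generated by ${}^{*}[0,\frac{1}{2})$, ${}^{*}[\frac{1}{2},1]$ and all singletons $\{a\}$ with $a\in{}^{*}[\frac{1}{2}-\frac{1}{N},\frac{1}{2}+\frac{1}{N}]$. Let $\mathcal{G}$ be the internal algebra on $\Omega$ generated by ${}^{*}[0,\frac{1}{2}-\frac{1}{N})$, ${}^{*}[\frac{1}{2}-\frac{1}{N},\frac{1}{2}+\frac{1}{N}]$ and ${}^{*}(\frac{1}{2}+\frac{1}{N},1]$. Let $\mu$ and $\nu$ be the restrictions of ${}^{*}\lambda$ to $\mathcal{F}$ and $\mathcal{G}$ respectively, and let $\mathcal{M}=(\Omega,\mathcal{F},\mu)$ and $\mathcal{N}=(\Omega,\mathcal{G},\nu)$. Then $\mathcal{N}$ is hyperfinite and $\mathcal{N}$ Loeb extends $\mathcal{M}$, but $\mathcal{M}$ is not Loeb equivalent to any hyperfinite probability space $(\Omega,\mathcal{G}',P)$.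
   Context: Work in a nonstandard extension satisfying transfer and (at least countable) saturation. An internal probability space is a triple $(\Omega,\mathcal{F},\mu)$ where $\Omega$ is an internal set, $\mathcal{F}$ is an internal algebra of internal subsets of $\Omega$, and $\mu:\mathcal{F}\to{}^{*}[0,1]$ is an internal finitely additive probability measure. It is called hyperfinite (a hyperfinite probability space) if $\mathcal{F}$ is hyperfinite; $\Omega$ need not be hyperfinite. The internal algebra generated by an internal family of internal subsets of $\Omega$ is the smallest internal algebra containing the family. For hyperreal $a\le b$ in ${}^{*}[0,1]$, ${}^{*}[a,b]$, ${}^{*}[a,b)$, ${}^{*}(a,b]$ denote the internal intervals of hyperreals with these endpoints. Write $\mathsf{st}$ for the standard part. The Loeb extension of $(\Omega,\mathcal{F},\mu)$ is the countably additive probability space $(\Omega,\overline{\mathcal{F}},\overline{\mu})$, where $\overline{\mathcal{F}}$ consists of all (not necessarily internal) $B\subset\Omega$ with $\sup\{\mathsf{st}(\mu(A)):A\in\mathcal{F},A\subset B\}=\inf\{\mathsf{st}(\mu(C)):C\in\mathcal{F},B\subset C\}$, and $\overline{\mu}(B)$ is this common value. For internal probability spaces $\mathcal{M}=(\Omega,\mathcal{F},\mu)$ and $\mathcal{N}=(\Omega,\mathcal{G},\nu)$: $\mathcal{N}$ Loeb extends $\mathcal{M}$ if $\overline{\mathcal{G}}\supset\overline{\mathcal{F}}$ and $\overline{\nu}$ extends $\overline{\mu}$ as a function; $\mathcal{N}$ is Loeb equivalent to $\mathcal{M}$ if $\overline{\mathcal{F}}=\overline{\mathcal{G}}$ and $\overline{\nu}=\overline{\mu}$.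 *)

(* Defs.v *)
From mathcomp Require Import all_boot all_order all_algebra.
From mathcomp Require Import all_classical all_reals all_analysis.
Set Implicit Arguments.
Unset Strict Implicit.
Unset Printing Implicit Defensive.
Import Order.TTheory GRing.Theory Num.Theory.
Local Open Scope classical_set_scope.
Local Open Scope ring_scope.

(* Nonstandard extensions are taken of the full higher-order structure over the
   reals: a standard object is a real, a set of objects of some type, or a
   function between two types (curried, for several arguments). *)
Inductive ty : Type := tR | tPow of ty | tFun of ty & ty.

Fixpoint std (R : realType) (t : ty) : Type :=
  match t with
  | tR => R
  | tPow t => set (std R t)
  | tFun s t => std R s -> std R t
  end.

(* The language: typed de Bruijn variables, a constant for every standard
   object, function application, equality and membership. *)
Inductive var : seq ty -> ty -> Type :=
| VZ (G : seq ty) (t : ty) : var (t :: G) t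
| VS (G : seq ty) (s t : ty) : var G t -> var (s :: G) t.

Inductive term (R : realType) (G : seq ty) : ty -> Type :=
| Var (t : ty) : var G t -> term R G t
| Cst (t : ty) : std R t -> term R G t
| App (s t : ty) : term R G (tFun s t) -> term R G s -> term R G t.

Inductive formula (R : realType) : seq ty -> Type :=
| FEq (G : seq ty) (t : ty) : term R G t -> term R G t -> formula R G
| FMem (G : seq ty) (t : ty) : term R G t -> term R G (tPow t) -> formula R G
| FNot (G : seq ty) : formula R G -> formula R G
| FAnd (G : seq ty) : formula R G -> formula R G -> formula R G
| FOr (G : seq ty) : formula R G -> formula R G -> formula R G
| FImp (G : seq ty) : formula R G -> formula R G -> formula R G
| FAll (G : seq ty) (t : ty) : formula R (t :: G) -> formula R G
| FEx (G : seq ty) (t : ty) : formula R (t :: G) -> formula R G.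

Record interpretation (R : realType) := Interpretation {
  dom :> ty -> Type;
  mem_dom : forall t : ty, dom t -> dom (tPow t) -> Prop;
  app_dom : forall s t : ty, dom (tFun s t) -> dom s -> dom t;
  star : forall t : ty, std R t -> dom t }.
Arguments mem_dom {R} i {t}.
Arguments app_dom {R} i {s t}.
Arguments star {R} i t.

Definition std_interpretation (R : realType) : interpretation R :=
  {| dom := std R;
     mem_dom := fun t (x : std R t) (A : std R (tPow t)) => A x;
     app_dom := fun s t (f : std R (tFun s t)) (x : std R s) => f x;
     star := fun t (x : std R t) => x |}.

Fixpoint env (R : realType) (M : interpretation R) (G : seq ty) : Type :=
  match G with
  | [::] => unit
  | t :: G => (M t * env M G)%type
  end.

Fixpoint var_val (R : realType) (M : interpretation R) (G : seq ty) (t : ty)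
    (v : var G t) : env M G -> M t :=
  match v in var G t return env M G -> M t with
  | VZ _ _ => fun e => e.1
  | VS _ _ _ v => fun e => var_val v e.2
  end.

Fixpoint term_val (R : realType) (M : interpretation R) (G : seq ty) (t : ty)
    (u : term R G t) (e : env M G) : M t :=
  match u in term _ _ t return M t with
  | Var _ v => var_val v e
  | Cst t c => star M t c
  | App _ _ f a => app_dom M (term_val f e) (term_val a e)
  end.

Fixpoint sat (R : realType) (M : interpretation R) (G : seq ty)
    (phi : formula R G) : env M G -> Prop :=
  match phi in formula _ G return env M G -> Prop with
  | FEq _ _ a b => fun e => term_val a e = term_val b e
  | FMem _ _ a A => fun e => mem_dom M (term_val a e) (term_val A e)
  | FNot _ p => fun e => ~ sat p e
  | FAnd _ p q => fun e => sat p e /\ sat q e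
  | FOr _ p q => fun e => sat p e \/ sat q e
  | FImp _ p q => fun e => sat p e -> sat q e
  | FAll _ t p => fun e => forall x : M t, sat (G := t :: _) p (x, e)
  | FEx _ t p => fun e => exists x : M t, sat (G := t :: _) p (x, e)
  end.

(* [dom E t] is the type of internal objects of type [t]; by transfer,
   internal sets and functions are extensional. *)
Record nonstandard_extension (R : realType) := NonstandardExtension {
  nse_interp :> interpretation R;
  transfer : forall phi : formula R [::],
    sat (M := std_interpretation R) phi tt <-> sat (M := nse_interp) phi tt;
  saturation : forall (t : ty) (A : nat -> nse_interp (tPow t)),
    (forall n : nat, exists x, forall i, (i < n)%N -> mem_dom nse_interp x (A i)) ->
    exists x, forall i, mem_dom nse_interp x (A i) }.

Section Internal.
Variables (R : realType) (E : nonstandard_extension R).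

Definition ext (t : ty) (A : E (tPow t)) : set (E t) :=
  [set x | mem_dom E x A].

Definition internal (t : ty) (X : set (E t)) : Prop :=
  exists A : E (tPow t), ext A = X.

Definition hyperfinite (t : ty) (X : set (E t)) : Prop :=
  exists2 A : E (tPow t), ext A = X &
    ext (star E (tPow (tPow t)) [set Y : set (std R t) | finite_set Y]) A.

Definition hreal (r : R) : E tR := star E tR r.

Definition lift1 (t : ty) (f : R -> std R t) (x : E tR) : E t :=
  app_dom E (star E (tFun tR t) f) x.

Definition lift2 (t : ty) (f : R -> R -> std R t) (x y : E tR) : E t :=
  app_dom E (app_dom E (star E (tFun tR (tFun tR t)) f) x) y.

Definition hadd : E tR -> E tR -> E tR := lift2 (t := tR) (fun x y => x + y).
Definition hsub : E tR -> E tR -> E tR := lift2 (t := tR) (fun x y => x - y).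
Definition hinv : E tR -> E tR := lift1 (t := tR) (fun x => x^-1).

Definition hle (x y : E tR) : Prop :=
  ext (lift1 (t := tPow tR) (fun b => [set a | a <= b]) y) x.
Definition hlt (x y : E tR) : Prop :=
  ext (lift1 (t := tPow tR) (fun b => [set a | a < b]) y) x.

Definition hset1 : E tR -> E (tPow tR) :=
  lift1 (t := tPow tR) (fun a => [set a]).
Definition hcc : E tR -> E tR -> E (tPow tR) :=
  lift2 (t := tPow tR) (fun a b => `[a, b]%classic).
Definition hco : E tR -> E tR -> E (tPow tR) :=
  lift2 (t := tPow tR) (fun a b => `[a, b[%classic).
Definition hoc : E tR -> E tR -> E (tPow tR) :=
  lift2 (t := tPow tR) (fun a b => `]a, b]%classic).

Definition hnat : set (E tR) :=
  ext (star E (tPow tR) (range (fun n : nat => n%:R : R))).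

Definition infinite_hnat (N : E tR) : Prop :=
  hnat N /\ forall n : nat, N <> hreal n%:R.

(* The standard part of a finite hyperreal; 0 on infinite ones. *)
Definition st (x : E tR) : R :=
  xget 0 [set r : R | forall e : R, 0 < e ->
    hlt (hreal (r - e)) x /\ hlt x (hreal (r + e))].

(* Lebesgue measure as a total real-valued function; its values on sets that
   are not measurable or have infinite measure are irrelevant. *)
Definition hlebesgue : E (tFun (tPow tR) tR) :=
  star E (tFun (tPow tR) tR) (fun A : set R => fine (lebesgue_measure A)).

End Internal.

Arguments hreal {R} E r.
Arguments hlebesgue {R} E.

Definition set_algebra (T : Type) (D : set T) (G : set (set T)) : Prop :=
  [/\ forall A, G A -> A `<=` D, G D & setring G].

Section InternalProbability.
Variables (R : realType) (E : nonstandard_extension R).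

(* The sample space is an internal set of objects of type [t]. The measure is
   an internal function on all internal sets of such objects, of which only the
   restriction to the algebra is meaningful: every internal function on an
   internal algebra has, by transfer, such an extension. *)
Record internal_space (t : ty) := InternalSpace {
  sample : E (tPow t);
  alg : set (E (tPow t));
  meas : E (tFun (tPow t) tR) }.

Definition internal_algebra (t : ty) (O : E (tPow t))
    (F : set (E (tPow t))) : Prop :=
  internal F /\ set_algebra (ext O) ((@ext R E t) @` F).

(* The intersection of all internal algebras on [O] containing [C]; it is the
   smallest internal algebra containing [C] as soon as it is internal, which
   transfer guarantees for an internal family [C] of internal subsets of [O]. *)
Definition generated_algebra (t : ty) (O : E (tPow t))
    (C : set (E (tPow t))) : set (E (tPow t)) :=
  smallest (internal_algebra O) C.

Definition mu (t : ty) (M : internal_space t) (A : E (tPow t)) : E tR :=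
  app_dom E (meas M) A.

Definition internal_probability (t : ty) (M : internal_space t) : Prop :=
  [/\ internal_algebra (sample M) (alg M),
      forall A, alg M A -> hle (hreal E 0) (mu M A) /\ hle (mu M A) (hreal E 1),
      mu M (sample M) = hreal E 1 &
      forall A B C, alg M A -> alg M B -> alg M C ->
        ext A `&` ext B = set0 -> ext C = ext A `|` ext B ->
        mu M C = hadd (mu M A) (mu M B)].

Definition hyperfinite_probability (t : ty) (M : internal_space t) : Prop :=
  internal_probability M /\ hyperfinite (alg M).

Definition Loeb_inner (t : ty) (M : internal_space t) (B : set (E t)) : R :=
  sup [set st (mu M A) | A in [set A | alg M A /\ ext A `<=` B]].

Definition Loeb_outer (t : ty) (M : internal_space t) (B : set (E t)) : R :=
  inf [set st (mu M C) | C in [set C | alg M C /\ B `<=` ext C]].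

Definition Loeb_measurable (t : ty) (M : internal_space t) (B : set (E t)) : Prop :=
  B `<=` ext (sample M) /\ Loeb_inner M B = Loeb_outer M B.

(* Meaningful on Loeb measurable sets only. *)
Definition Loeb_measure (t : ty) (M : internal_space t) (B : set (E t)) : R :=
  Loeb_inner M B.

Definition Loeb_extends (t : ty) (N M : internal_space t) : Prop :=
  forall B, Loeb_measurable M B ->
    Loeb_measurable N B /\ Loeb_measure N B = Loeb_measure M B.

Definition Loeb_equivalent (t : ty) (N M : internal_space t) : Prop :=
  (forall B, Loeb_measurable N B <-> Loeb_measurable M B) /\
  (forall B, Loeb_measurable M B -> Loeb_measure N B = Loeb_measure M B).

End InternalProbability.

(* Main.v *)
Require Import Defs.
From mathcomp Require Import all_boot all_order all_algebra.
From mathcomp Require Import all_classical all_reals all_analysis.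
From mathcomp Require Import lra.
Import Order.TTheory GRing.Theory Num.Theory.
Local Open Scope classical_set_scope.
Local Open Scope ring_scope.

(** Write a = 1/2 - 1/N, b = 1/2 + 1/N and K = *[a, b]. Every set in the
    algebra F of the first space agrees, up to an internally finite subset of
    K, with one of the four unions of the two halves of *[0, 1], whereas the
    algebra G of the second space has the three atoms *[0, a), K and *(b, 1],
    and K has infinitesimal measure 2/N.

    The second space Loeb extends the first one because for every A in F both
    A \ K and A U K belong to G: outside K the set A is a union of some of the
    two remaining atoms ([cutF_approx]). These two sets enclose A, and their
    measures are infinitely close to that of A, so the inner Loeb measure of
    any set can only increase from F to G, and its outer measure can only
    decrease ([Loeb_extends_approx]).

    No hyperfinite space X is Loeb equivalent to the first one. Indeed a point
    x of K has Loeb measure 0, hence lies in some C of the algebra of X whose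
    measure is less than 1/2. The Loeb measure of C is the same in the first
    space, so C is included in some D in F of measure less than 1/2. But a set
    in F either is internally finite or has measure at least 1/2
    ([cutF_finite_or_half]), so D and C are internally finite. Thus K is
    covered by internally finite members of a hyperfinite family, hence is
    internally finite, which is absurd ([hcc_not_covered]).

    The facts about the internal objects are instances of transfer. A generated
    internal algebra is the star image of a generated algebra of standard sets
    ([generated_algebraE]), so that what has to be proved concerns the algebras
    generated by the same sets for real numbers 0 <= a < 1/2 < b <= 1. The
    formulas to which the transfer principle applies are computed from their
    meaning in the extension by type class inference ([reif], [transfer]). *)

Set Implicit Arguments.
Unset Strict Implicit.
Unset Printing Implicit Defensive.

(** * Reification of transferable statements *)

Section Reification.
Variables (R : realType) (M : interpretation R).

Class reif_term (G : seq ty) (t : ty) (f : env M G -> M t) (u : term R G t) :=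
  reif_termE : forall e, term_val u e = f e.

Class reif (G : seq ty) (P : env M G -> Prop) (phi : formula R G) :=
  reifE : forall e, sat phi e <-> P e.

(* An instance per de Bruijn index: a single instance for [VS] would need the
   unification of [?f e.2] with nested projections of [e], which is not a
   higher-order pattern. *)
#[export] Instance reif_var0 G t :
  @reif_term (t :: G) t (fun e => e.1) (Var R (VZ G t)).
Proof. by []. Qed.

#[export] Instance reif_var1 G s t :
  @reif_term (s :: t :: G) t (fun e => e.2.1) (Var R (VS s (VZ G t))).
Proof. by []. Qed.

#[export] Instance reif_var2 G r s t :
  @reif_term (r :: s :: t :: G) t (fun e => e.2.2.1)
    (Var R (VS r (VS s (VZ G t)))).
Proof. by []. Qed.

#[export] Instance reif_var3 G q r s t :
  @reif_term (q :: r :: s :: t :: G) t (fun e => e.2.2.2.1)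
    (Var R (VS q (VS r (VS s (VZ G t))))).
Proof. by []. Qed.

#[export] Instance reif_star G t (c : std R t) :
  @reif_term G t (fun=> star M t c) (Cst G c).
Proof. by []. Qed.

#[export] Instance reif_app G s t (f : env M G -> M (tFun s t)) g u v :
  reif_term f u -> reif_term g v ->
  reif_term (fun e => app_dom M (f e) (g e)) (App u v).
Proof. by move=> fu gv e /=; rewrite fu gv. Qed.

#[export] Instance reif_eq G t (f g : env M G -> M t) u v :
  reif_term f u -> reif_term g v -> reif (fun e => f e = g e) (FEq u v).
Proof. by move=> fu gv e /=; rewrite fu gv. Qed.

#[export] Instance reif_mem G t (f : env M G -> M t) g u v :
  reif_term f u -> reif_term g v ->
  reif (fun e => mem_dom M (f e) (g e)) (FMem u v).
Proof. by move=> fu gv e /=; rewrite fu gv. Qed.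

#[export] Instance reif_not G (P : env M G -> Prop) p :
  reif P p -> reif (fun e => ~ P e) (FNot p).
Proof. by move=> Pp e /=; rewrite Pp. Qed.

#[export] Instance reif_and G (P Q : env M G -> Prop) p q :
  reif P p -> reif Q q -> reif (fun e => P e /\ Q e) (FAnd p q).
Proof. by move=> Pp Qq e /=; rewrite Pp Qq. Qed.

#[export] Instance reif_or G (P Q : env M G -> Prop) p q :
  reif P p -> reif Q q -> reif (fun e => P e \/ Q e) (FOr p q).
Proof. by move=> Pp Qq e /=; rewrite Pp Qq. Qed.

#[export] Instance reif_imp G (P Q : env M G -> Prop) p q :
  reif P p -> reif Q q -> reif (fun e => P e -> Q e) (FImp p q).
Proof. by move=> Pp Qq e /=; rewrite Pp Qq. Qed.

#[export] Instance reif_all G t (P : env M G -> M t -> Prop) p :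
  @reif (t :: G) (fun e => P e.2 e.1) p ->
  reif (fun e => forall x, P e x) (FAll p).
Proof. by move=> Pp e; split=> H x; apply/(Pp (x, e))/H. Qed.

#[export] Instance reif_ex G t (P : env M G -> M t -> Prop) p :
  @reif (t :: G) (fun e => P e.2 e.1) p ->
  reif (fun e => exists x, P e x) (FEx p).
Proof. by move=> Pp e; split=> -[x H]; exists x; apply/(Pp (x, e))/H. Qed.

End Reification.

Lemma transfer_reif (R : realType) (E : nonstandard_extension R) (P : Prop)
    (phi : formula R [::]) (Pphi : reif (M := E) (G := [::]) (fun=> P) phi) :
  sat (M := std_interpretation R) phi tt -> P.
Proof. by move=> /(transfer E)/(Pphi tt). Qed.

Create HintDb star.
#[export] Hint Unfold ext hreal lift1 lift2 hadd hsub hinv hle hlt hset1 hcc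
  hco hoc hnat hlebesgue iff subset mkset : star.

(** [transfer] replaces a closed statement about the extension by the same
    statement about standard objects. Hypotheses on standard objects, which the
    language cannot express, have to stay in the proof context. *)
Ltac transfer :=
  repeat (autounfold with star); cbv beta;
  (* without [once], a later failure would restart the instance search and
     hide its own error message *)
  notypeclasses refine (transfer_reif _ _); [once (typeclasses eauto)|
    lazy beta iota zeta delta [sat term_val var_val dom mem_dom app_dom star
      std_interpretation std fst snd mkset]].

(** * Generated algebras of sets *)

(** As in the definition of internal generated algebras, but ranging over all
    algebras. *)
Definition gen (T : Type) (O : set T) (C : set (set T)) : set (set T) :=
  smallest (set_algebra O) C.

Section SetAlgebra.
Variables (T : Type) (O : set T).
Implicit Types (A U : set T) (C H P : set (set T)).

Lemma set_algebraI P : setring P -> P O ->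
  set_algebra O [set A | A `<=` O /\ P A].
Proof.
move=> [P0 PU PD] PO; split=> [A []//||]; first by split.
split=> [|A B [AO PA] [BO PB]|A B [AO PA] [BO PB]]; split=> //.
- by rewrite subUset.
- exact: PU.
- by move=> x [/AO].
- exact: PD.
Qed.

Lemma gen_ind C P : setring P -> P O -> (forall A, C A -> A `<=` O /\ P A) ->
  forall A, gen O C A -> A `<=` O /\ P A.
Proof.
by move=> Pring PO CP; apply: smallest_sub => //; exact: set_algebraI.
Qed.

Lemma setringT : setring [set: set T].
Proof. by split. Qed.

Lemma gen_algebra C : (forall A, C A -> A `<=` O) -> set_algebra O (gen O C).
Proof.
move=> CO; split.
- by move=> A /(gen_ind setringT) []// B /CO.
- by move=> H [[]].
- split=> [|A B gA gB|A B gA gB] H HC; have [[_ _ [H0 HU HD]] _] := HC => //.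
  + by apply: HU; [exact: gA|exact: gB].
  + by apply: HD; [exact: gA|exact: gB].
Qed.

Lemma gen_incl C : C `<=` gen O C.
Proof. exact: sub_gen_smallest. Qed.

Definition constant_on U A := U `&` A = set0 \/ U `<=` A.

Lemma constant_on_setring U : setring (constant_on U).
Proof.
split=> [|A B|A B]; first by left; rewrite setI0.
- case=> [A0|UA]; last by right; move=> x /UA; left.
  case=> [B0|UB]; last by right; move=> x /UB; right.
  by left; rewrite setIUr A0 B0 setU0.
- case=> [A0|UA]; first by left; rewrite setDE setIA A0 set0I.
  case=> [B0|UB]; last first.
    by left; apply/seteqP; split=> x // [Ux [_]]; apply; exact: UB.
  right=> x Ux; split; first exact: UA.
  by move=> Bx; have : (U `&` B) x by []; rewrite B0.
Qed.

Definition almost_constant_on U A :=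
  finite_set (U `&` A) \/ finite_set (U `\` A).

Lemma almost_constant_on_setring U : setring (almost_constant_on U).
Proof.
split=> [|A B|A B]; first by left; rewrite setI0.
- case=> [fA|fA]; last first.
    right; apply: sub_finite_set fA => x [? nAB].
    by split=> // Ax; apply: nAB; left.
  case=> [fB|fB]; last first.
    right; apply: sub_finite_set fB => x [? nAB].
    by split=> // Ax; apply: nAB; right.
  by left; rewrite setIUr finite_setU.
- case=> [fA|fA]; first by left; apply: sub_finite_set fA => x [? []].
  case=> [fB|fB]; last by left; apply: sub_finite_set fB => x [? []].
  right; have : finite_set ((U `\` A) `|` (U `&` B)) by rewrite finite_setU.
  apply: sub_finite_set => x [Ux nAB].
  have [Ax|nAx] := pselect (A x); last by left.
  by right; split=> //; apply: contrapT => nBx; apply: nAB.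
Qed.

End SetAlgebra.

(** A set in the algebra generated by a partition is determined by the parts
    that it contains, since it is constant on each part. *)
Lemma finite_gen (T : Type) (O U V W : set T) :
  O = U `|` V `|` W ->
  (forall X Y, [set U; V; W] X -> [set U; V; W] Y -> constant_on X Y) ->
  finite_set (gen O [set A | [\/ A = U, A = V | A = W]]).
Proof.
move=> OE disj; pose f (p : bool * bool * bool) : set T :=
  (if p.1.1 then U else set0) `|` (if p.1.2 then V else set0)
    `|` (if p.2 then W else set0).
apply: (@sub_finite_set _ _ (range f)); last first.
  exact/finite_image/finite_finset.
have cst X : [set U; V; W] X -> forall A,
    gen O [set A | [\/ A = U, A = V | A = W]] A -> A `<=` O /\ constant_on X A.
  move=> CX; apply: gen_ind => [||A /= CA].
  - exact: constant_on_setring.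
  - right; rewrite OE; case: CX => [[->|->]|->] x Xx;
      by [left; left|left; right|right].
  - split; last by apply: disj => //; case: CA; [left; left|left; right|right].
    by rewrite OE; case: CA => -> x Xx; [left; left|left; right|right].
move=> A gA.
have [|AO cU] := cst U _ A gA; first by left; left.
have [|_ cV] := cst V _ A gA; first by left; right.
have [|_ cW] := cst W _ A gA; first by right.
have trace X : constant_on X A ->
    exists p : bool, (if p then X else set0) = X `&` A.
  by case=> [->|/setIidPl ->]; [exists false|exists true].
case: (trace _ cU) (trace _ cV) (trace _ cW) => p pE [q qE] [r rE].
exists (p, q, r) => //; rewrite /f /= pE qE rE -!setIUl -OE.
exact/setIidPr.
Qed.

(** * Lebesgue measure on the unit interval *)

Section Lebesgue.
Variable R : realType.
Implicit Types (A B K U : set R) (C : set (set R)).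

Definition lambda (A : set R) : R := fine (lebesgue_measure A).

Definition mes01 : set (set R) :=
  [set A : set R | A `<=` `[0, 1] /\ measurable A].

Lemma mes01T : mes01 `[0, 1]%classic.
Proof. by split. Qed.

Lemma itv_mes01 (x y : R) (u v : bool) : 0 <= x -> y <= 1 ->
  mes01 [set` Interval (BSide u x) (BSide v y)].
Proof.
move=> x0 y1; split; last exact: measurable_itv.
move=> z; rewrite /= !in_itv/=.
move=> /andP[xz zy]; apply/andP; split.
- by apply: le_trans x0 _; case: u xz => // /ltW.
- by apply: le_trans _ y1; case: v zy => // /ltW.
Qed.

Lemma mes01_setring : setring mes01.
Proof.
split=> [|A B [A1 mA] [B1 mB]|A B [A1 mA] [B1 mB]]; split=> //.
- by rewrite subUset.
- exact: measurableU.
- by move=> x [/A1].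
- exact: measurableD.
Qed.

Lemma gen_mes01 C : C `<=` mes01 -> gen `[0, 1]%classic C `<=` mes01.
Proof.
move=> CM A /(gen_ind mes01_setring mes01T) []// B /CM BM.
by split=> //; case: BM.
Qed.

Lemma mes01_fin A : mes01 A -> lebesgue_measure A \is a fin_num.
Proof.
move=> [A01 mA]; rewrite ge0_fin_numE//.
apply: (@le_lt_trans _ _ (lebesgue_measure (`[0, 1]%classic : set R))).
  by apply: le_measure; rewrite ?inE//.
by rewrite lebesgue_measure_itv /= lte_fin ltr01 -EFinD ltry.
Qed.

Lemma lambda_itv (a b : R) (x y : bool) : a <= b ->
  lambda [set` Interval (BSide x a) (BSide y b)] = b - a.
Proof.
rewrite /lambda lebesgue_measure_itv /= lte_fin le_eqVlt => /predU1P[->|->//].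
by rewrite ltxx subrr.
Qed.

Lemma lambda_finite A : finite_set A -> lambda A = 0.
Proof.
move=> /finite_set_countable/countable_lebesgue_measure0.
by rewrite /lambda => ->.
Qed.

Lemma lambda_ge0 A : 0 <= lambda A.
Proof. exact/fine_ge0. Qed.

Lemma lambdaU A B : mes01 A -> mes01 B -> A `&` B = set0 ->
  lambda (A `|` B) = lambda A + lambda B.
Proof.
move=> A1 B1 AB; rewrite /lambda measureU//; [|exact: A1.2|exact: B1.2].
by rewrite fineD// mes01_fin.
Qed.

Lemma lambda_le A B : mes01 A -> mes01 B -> A `<=` B -> lambda A <= lambda B.
Proof.
move=> A1 B1 AB; have BE : B = A `|` (B `\` A) by rewrite setDUK.
rewrite BE lambdaU ?lerDl ?lambda_ge0 ?setDIK//.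
by have [_ _ ] := mes01_setring; apply.
Qed.

Lemma lambda_le1 A : mes01 A -> lambda A <= 1.
Proof.
move=> A1; rewrite -[leRHS](subr0 1) -(@lambda_itv 0 1 true false)//.
exact: lambda_le A1 mes01T A1.1.
Qed.

Lemma lambda_leU A B K : mes01 A -> mes01 B -> mes01 K -> A `<=` B `|` K ->
  lambda A <= lambda B + lambda K.
Proof.
move=> A1 B1 K1 ABK; have [_ mU mD] := mes01_setring.
apply: le_trans (lambda_le A1 (mU _ _ B1 K1) ABK) _.
have -> : B `|` K = B `|` (K `\` B).
  apply/seteqP; split=> x; last by case=> [|[]]; [left|right].
  by have [|nBx [//|Kx]] := pselect (B x); [left|right].
rewrite lambdaU ?setDIK//; last exact: mD.
by rewrite lerD2l lambda_le//; exact: mD.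
Qed.

(** * The two algebras for standard cut points *)

Section Cut.
Variables a b : R.

Definition cutF : set (set R) :=
  [set A : set _ | [\/ A = `[0, 2^-1[%classic, A = `[2^-1, 1]%classic
                     | exists2 x : R, `[a, b]%classic x & A = [set x]]].

Definition cutG : set (set R) :=
  [set A : set _ | [\/ A = `[0, a[%classic, A = `[a, b]%classic
                     | A = `]b, 1]%classic]].

Lemma cutF_mes01 : 0 <= a -> a < 2^-1 -> 2^-1 < b -> b <= 1 ->
  cutF `<=` mes01.
Proof.
move=> a0 ah hb b1 A [->|->|[x xab ->]].
- by apply: itv_mes01 => //; lra.
- by apply: itv_mes01 => //; lra.
- split; last exact: measurable_set1.
  by move=> _ ->; move: xab; rewrite /= !in_itv/=; intros; lra.
Qed.

Lemma cutG_mes01 : 0 <= a -> a < 2^-1 -> 2^-1 < b -> b <= 1 ->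
  cutG `<=` mes01.
Proof.
by move=> a0 ah hb b1 A [->|->|->]; apply: itv_mes01 => //; lra.
Qed.

Lemma cutG_finite : 0 <= a -> a < 2^-1 -> 2^-1 < b -> b <= 1 ->
  finite_set (gen `[0, 1]%classic cutG).
Proof.
move=> a0 ah hb b1; apply: finite_gen.
  apply/seteqP; split=> x /=; rewrite !in_itv/=;
    [|by case=> [[]|]; intros; lra].
  move=> x01; have [xa|ax] := ltP x a; first by left; left; lra.
  by have [xb|bx] := leP x b; [left; right|right]; lra.
move=> X Y [[->|->]|->] [[->|->]|->]; (try by right);
  left; apply/seteqP; split=> x //=; rewrite !in_itv/=; case; intros; lra.
Qed.

(** The generators, hence all sets of the algebra, are finite or cofinite in
    each half of [0, 1]; a cofinite subset of a half has measure 1/2. *)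
Lemma cutF_finite_or_half A : 0 <= a -> a < 2^-1 -> 2^-1 < b -> b <= 1 ->
  gen `[0, 1]%classic cutF A -> finite_set A \/ 2^-1 <= lambda A.
Proof.
move=> a0 ah hb b1 FA; have FM := cutF_mes01 a0 ah hb b1.
have A1 := gen_mes01 FM FA; have [_ mU mD] := mes01_setring.
have half_or U : mes01 U -> lambda U = 2^-1 -> finite_set (U `\` A) ->
    2^-1 <= lambda A.
  move=> U1 <- fUA; have UA1 := mD _ _ U1 A1.
  rewrite -[leRHS]addr0 -(lambda_finite fUA); apply: lambda_leU => //.
  by move=> x Ux; have [|] := pselect (A x); [left|right].
have alm U : mes01 U ->
    (forall B, cutF B -> ~ finite_set B -> almost_constant_on U B) ->
    almost_constant_on U A.
  move=> [U01 _] UB; apply: (gen_ind _ _ _ FA).2.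
  - exact: almost_constant_on_setring.
  - by right; move: U01; rewrite -setD_eq0 => ->.
  - move=> B FB; split; first exact: (FM _ FB).1.
    by have [fB|] := pselect (finite_set B);
      [left; exact: finite_setIr|exact: UB].
have L1 : mes01 `[0, 2^-1[%classic by apply: itv_mes01 => //; lra.
have R1 : mes01 `[2^-1, 1]%classic by apply: itv_mes01 => //; lra.
have LR : `[0, 2^-1[ `&` `[2^-1, 1] = set0 :> set R.
  by apply/seteqP; split=> x //=; rewrite !in_itv/=; case; intros; lra.
have aL : almost_constant_on `[0, 2^-1[ A.
  apply: alm => // B [->|->|[x _ ->]].
  - by move=> _; right; rewrite setDv.
  - by move=> _; left; rewrite LR.
  - by case; exact: finite_set1.
have aR : almost_constant_on `[2^-1, 1] A.
  apply: alm => // B [->|->|[x _ ->]].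
  - by move=> _; left; rewrite setIC LR.
  - by move=> _; right; rewrite setDv.
  - by case; exact: finite_set1.
case: aL => fL; last by right; apply: half_or fL => //; rewrite lambda_itv; lra.
case: aR => fR; last by right; apply: half_or fR => //; rewrite lambda_itv; lra.
left; have : finite_set ((`[0, 2^-1[ `&` A) `|` (`[2^-1, 1] `&` A)).
  by rewrite finite_setU.
apply: sub_finite_set => x Ax; have := A1.1 x Ax; rewrite /= !in_itv/= => x01.
by case: (ltP x 2^-1) x01; [left|right]; split=> //=; rewrite ?andbT;
  case/andP: x01 => ? ?.
Qed.

(** With K = [a, b], the approximating sets are A \ K and A U K: as A is
    constant on [0, a[ and on ]b, 1], both belong to the second algebra. *)
Lemma cutF_approx A : 0 <= a -> a < 2^-1 -> 2^-1 < b -> b <= 1 ->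
  gen `[0, 1]%classic cutF A ->
  (exists2 D, gen `[0, 1]%classic cutG D &
     D `<=` A /\ lambda A <= lambda D + (b - a)) /\
  (exists2 D, gen `[0, 1]%classic cutG D &
     A `<=` D /\ lambda D <= lambda A + (b - a)).
Proof.
move=> a0 ah hb b1 FA.
have FM := cutF_mes01 a0 ah hb b1; have GM := cutG_mes01 a0 ah hb b1.
have A1 := gen_mes01 FM FA; have gM := gen_mes01 GM.
have [_ gT [g0 gU gD]] : set_algebra `[0, 1]%classic (gen `[0, 1]%classic cutG).
  by apply: gen_algebra => B /GM[].
have gK : gen `[0, 1]%classic cutG `[a, b]%classic.
  by apply: gen_incl; apply: Or32.
have <- : lambda `[a, b]%classic = b - a by rewrite lambda_itv; lra.
have cst U : cutG U -> (forall B, cutF B -> constant_on U B) ->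
    gen `[0, 1]%classic cutG (U `&` A).
  move=> GU UB; have [] : A `<=` `[0, 1] /\ constant_on U A.
    apply: gen_ind FA => [||B FB].
    - exact: constant_on_setring.
    - by right; exact: (GM _ GU).1.
    - by split; [exact: (FM _ FB).1|exact: UB].
  by move=> _ [->//|/setIidPl ->]; exact: gen_incl.
have gl : gen `[0, 1]%classic cutG (`[0, a[ `&` A).
  apply: cst => [|B]; first exact: Or31.
  case=> [->|->|[x + ->]].
  - by right=> y /=; rewrite !in_itv/=; intros; lra.
  - by left; apply/seteqP; split=> y //=; rewrite !in_itv/= => -[]; intros; lra.
  - rewrite /= in_itv/= => xab; left; apply/seteqP; split=> y //=.
    by rewrite in_itv/= => -[+ yx]; rewrite yx; intros; lra.
have gr : gen `[0, 1]%classic cutG (`]b, 1] `&` A).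
  apply: cst => [|B]; first exact: Or33.
  case=> [->|->|[x + ->]].
  - by left; apply/seteqP; split=> y //=; rewrite !in_itv/= => -[]; intros; lra.
  - by right=> y /=; rewrite !in_itv/=; intros; lra.
  - rewrite /= in_itv/= => xab; left; apply/seteqP; split=> y //=.
    by rewrite in_itv/= => -[+ yx]; rewrite yx; intros; lra.
have AK : A `\` `[a, b] = (`[0, a[ `&` A) `|` (`]b, 1] `&` A).
  apply/seteqP; split=> x /=; last first.
    by rewrite !in_itv/= => -[] [? ?]; split=> //; lra.
  rewrite !in_itv/= => -[Ax /negP xab].
  have := A1.1 _ Ax; rewrite /= in_itv/= => x01.
  by have [xa|ax] := ltP x a; [left|right]; split=> //; lra.
have gAK : gen `[0, 1]%classic cutG (A `\` `[a, b]) by rewrite AK; exact: gU.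
split.
- exists (A `\` `[a, b]) => //; split; first by move=> x [].
  apply: lambda_leU => //; [exact: gM|exact: gM|].
  by move=> x Ax; have [|] := pselect (`[a, b]%classic x); [right|left].
- exists ((A `\` `[a, b]) `|` `[a, b]); first exact: gU.
  have KA : (A `\` `[a, b]) `|` `[a, b] `<=` A `|` `[a, b].
    by move=> x [[]|]; [left|right].
  split; last by apply: lambda_leU KA => //; apply: gM => //; exact: gU.
  by move=> x Ax; have [|] := pselect (`[a, b]%classic x); [right|left].
Qed.

End Cut.
End Lebesgue.

(** * Internal algebras *)

Definition halgebra (R : realType) (E : nonstandard_extension R) (t : ty)
    (O : E (tPow t)) : E (tPow (tPow (tPow t))) :=
  app_dom E (star E (tFun (tPow t) (tPow (tPow (tPow t))))
    (fun O : set (std R t) => [set H | set_algebra O H])) O.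

Definition hgen (R : realType) (E : nonstandard_extension R) (t : ty)
    (O : E (tPow t)) (C : E (tPow (tPow t))) : E (tPow (tPow t)) :=
  app_dom E (app_dom E
    (star E (tFun (tPow t) (tFun (tPow (tPow t)) (tPow (tPow t))))
      (@gen (std R t))) O) C.

Definition hfinite (R : realType) (E : nonstandard_extension R) (t : ty)
    (A : E (tPow t)) : Prop :=
  ext (star E (tPow (tPow t)) [set Y : set (std R t) | finite_set Y]) A.

#[export] Hint Unfold halgebra hgen hfinite : star.

Section InternalAlgebra.
Variables (R : realType) (E : nonstandard_extension R) (t : ty).

Lemma ext_inj : injective (@ext R E t).
Proof.
move=> A B AB; have : forall x, ext A x <-> ext B x by rewrite AB.
by clear AB; move: A B; transfer => A B AB; apply/seteqP; split=> x /AB.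
Qed.

(** The axioms of an algebra of sets can be written elementwise in the
    language, so an internal family satisfies them internally if and only if
    the family of its extensions does. *)
Lemma halgebraP (O : E (tPow t)) (H : E (tPow (tPow t))) :
  ext (halgebra O) H <-> set_algebra (ext O) (@ext R E t @` ext H).
Proof.
have -> : ext (halgebra O) H <->
  (forall A, ext H A -> forall x, ext A x -> ext O x) /\ ext H O /\
  (exists Z, ext H Z /\ forall x, ~ ext Z x) /\
  (forall A B, ext H A -> ext H B ->
     exists C, ext H C /\ forall x, ext C x <-> ext A x \/ ext B x) /\
  (forall A B, ext H A -> ext H B ->
     exists C, ext H C /\ forall x, ext C x <-> ext A x /\ ~ ext B x).
  move: O H; transfer => O H.
  split=> [[HO OH [H0 HU HD]] | [HO [OH [[Z [HZ Z0]] [HU HD]]]]].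
  - split; [exact: HO|split=> //; split; first by exists set0; split=> // x []].
    split=> A B HA HB; [exists (A `|` B)|exists (A `\` B)]; (split; last by []).
    + exact: HU.
    + exact: HD.
  - split=> //; split=> [|A B HA HB|A B HA HB].
    + by rewrite (_ : set0 = Z)//; apply/seteqP; split=> x // /Z0.
    + have [C [HC CE]] := HU A B HA HB.
      by rewrite (_ : _ `|` _ = C)//; apply/seteqP; split=> x /CE.
    + have [C [HC CE]] := HD A B HA HB.
      by rewrite (_ : _ `\` _ = C)//; apply/seteqP; split=> x /CE.
split=> [[HO [OH [[Z [HZ Z0]] [HU HD]]]] | [HO [Q HQ QE] [[Z HZ Z0] HU HD]]].
- split=> [_ [A HA <-]||]; [exact: HO|by exists O|].
  split=> [|_ _ [A HA <-] [B HB <-]|_ _ [A HA <-] [B HB <-]].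
  + by exists Z => //; apply/seteqP; split=> x // /Z0.
  + have [C [HC CE]] := HU A B HA HB.
    by exists C => //; apply/seteqP; split=> x /CE.
  + have [C [HC CE]] := HD A B HA HB.
    by exists C => //; apply/seteqP; split=> x /CE.
- split; first by move=> A HA; apply: HO; exists A.
  split; first by rewrite -(ext_inj QE).
  split; first by exists Z; split=> // x; rewrite Z0.
  split=> A B HA HB.
  + have [||C HC CE] := HU (ext A) (ext B); [by exists A|by exists B|].
    by exists C; rewrite CE.
  + have [||C HC CE] := HD (ext A) (ext B); [by exists A|by exists B|].
    by exists C; rewrite CE.
Qed.

(** By transfer the star image of generation yields the smallest among the
    internal algebras that contain the family. *)
Lemma generated_algebraE (O : E (tPow t)) (C : E (tPow (tPow t))) :
  (forall A, ext C A -> ext A `<=` ext O) ->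
  generated_algebra O (ext C) = ext (hgen O C) /\
  internal_algebra O (ext (hgen O C)).
Proof.
move=> CO.
have [gO [Cg g_min]] : ext (halgebra O) (hgen O C) /\
    (forall A, ext C A -> ext (hgen O C) A) /\
    (forall H, ext (halgebra O) H -> (forall A, ext C A -> ext H A) ->
       forall A, ext (hgen O C) A -> ext H A).
  move: O C CO; transfer => O C CO; split; [|split].
  - exact: gen_algebra.
  - exact: gen_incl.
  - by move=> H HO CH; exact: smallest_sub.
have algO : internal_algebra O (ext (hgen O C)).
  by split; [exists (hgen O C)|exact/halgebraP].
split=> //; apply/seteqP; split; first exact: smallest_sub.
move=> A gA _ [[[H <-] /halgebraP HO] CH]; exact: g_min gA.
Qed.

End InternalAlgebra.

(** * Standard parts *)

Section StandardPart.
Variables (R : realType) (E : nonstandard_extension R).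
Implicit Types (x y : E tR) (p q r e : R).

Definition unit_hreal x := hle (hreal E 0) x /\ hle x (hreal E 1).

Definition is_st x r := forall e, 0 < e ->
  hlt (hreal E (r - e)) x /\ hlt x (hreal E (r + e)).

Lemma hlt_hreal_trans p q x :
  hlt (hreal E p) x -> hlt x (hreal E q) -> p < q.
Proof.
move=> px xq; apply: contrapT => /negP; rewrite -leNgt => qp.
suff : ~ hlt x (hreal E q) by [].
move: x px {xq}; transfer => x px; apply/negP; rewrite -leNgt.
by apply: le_trans (ltW px).
Qed.

Lemma st_unique x r : is_st x r -> st x = r.
Proof.
move=> xr; apply: xget_unique => // s xs; apply: contrapT => /eqP.
have lt_add p q e : is_st x p -> is_st x q -> 0 < e -> p < q + e + e.
  move=> xp xq e0; rewrite -ltrBlDr.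
  exact: hlt_hreal_trans (xp _ e0).1 (xq _ e0).2.
by case: ltgtP => // [sr|rs] _;
  [have := lt_add r s ((r - s) / 2) xr xs
  |have := lt_add s r ((s - r) / 2) xs xr]; lra.
Qed.

(** The standard part of x is the supremum of the real numbers below x. *)
Lemma is_stP x : unit_hreal x -> is_st x (st x).
Proof.
move=> [x0 x1]; pose S := [set r | hle (hreal E r) x].
have S1 : ubound S 1.
  move=> r rx; apply: contrapT => /negP; rewrite -ltNge => r1.
  suff : ~ hle (hreal E r) x by [].
  move: x x1 {rx x0 S}; transfer => x x1; apply/negP; rewrite -ltNge.
  exact: le_lt_trans r1.
have supS : has_sup S by split; [exists 0|exists 1].
suff xS : is_st x (sup S) by rewrite (st_unique xS).
move=> e e0; split.
- have [r] := sup_adherent e0 supS; rewrite /S /=.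
  move: (sup S - e) => q + qr; move: qr; clear=> qr.
  by move: x; transfer => x; exact: lt_le_trans.
- have [//|] : hlt x (hreal E (sup S + e)) \/ hle (hreal E (sup S + e)) x.
    move: (sup S + e) => q; move: x {x0 x1 S S1 supS}.
    by transfer => x; case: ltP; [left|right].
  by move=> /(ub_le_sup (ex_intro _ _ S1)); rewrite gerDl leNgt e0.
Qed.

Lemma st_leD x y e : unit_hreal x -> unit_hreal y ->
  hle x (hadd y (hreal E e)) -> st x <= st y + e.
Proof.
move=> /is_stP xs /is_stP ys xye; rewrite leNgt; apply/negP => lt_st.
have [d d0 dE] : exists2 d, 0 < d & st x - d = st y + d + e.
  by exists ((st x - st y - e) / 2); lra.
suff : ~ hle x (hadd y (hreal E e)) by [].
have [xd _] := xs _ d0; have [_ yd] := ys _ d0.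
move: (st x - d) (st y + d) dE xd yd => p q pqe.
by clear -pqe; move: x y; transfer => x y; lra.
Qed.

Lemma le_st x y : unit_hreal x -> unit_hreal y -> hle x y -> st x <= st y.
Proof.
move=> x1 y1 xy; rewrite -[leRHS]addr0; apply: st_leD => //.
by move: x y xy {x1 y1}; transfer => x y; rewrite addr0.
Qed.

Lemma st_hreal r : st (hreal E r) = r.
Proof.
apply: st_unique => e e0.
have ltB : r - e < r by lra.
have ltD : r < r + e by lra.
by split; transfer.
Qed.

End StandardPart.

(** * Loeb measures *)

Section Loeb.
Variables (R : realType) (E : nonstandard_extension R) (t : ty).
Variable M : internal_space E t.
Hypothesis M_prob : internal_probability M.
Implicit Types (A C : E (tPow t)) (B : set (E t)).

Lemma prob_unit A : alg M A -> unit_hreal (mu M A).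
Proof. by case: M_prob => _ + _ _; apply. Qed.

Lemma alg_sample A : alg M A -> ext A `<=` ext (sample M).
Proof.
by case: M_prob => -[_ [+ _ _]] _ _ _ MA; apply; exists A.
Qed.

Lemma alg_full : alg M (sample M).
Proof.
by case: M_prob => -[_ [_ [A MA /ext_inj AO] _]] _ _ _; rewrite -AO.
Qed.

Lemma alg_empty : exists2 A, alg M A & ext A = set0.
Proof.
by case: M_prob => -[_ [_ _ [[A MA A0] _ _]]] _ _ _; exists A.
Qed.

Lemma mu_le A C : alg M A -> alg M C -> ext A `<=` ext C ->
  hle (mu M A) (mu M C).
Proof.
move=> MA MC AC.
have [D MD DE] : exists2 D, alg M D & ext D = ext C `\` ext A.
  case: M_prob => -[_ [_ _ [_ _ MB]]] _ _ _.
  by have [||D MD DE] := MB (ext C) (ext A);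
    [by exists C|by exists A|exists D].
case: M_prob => _ mu01 _ muU; have [D0 _] := mu01 _ MD.
rewrite (muU A D C) ?DE ?setDIK ?setDUK//.
by move: (mu M A) (mu M D) D0; transfer => x y y0; rewrite lerDl.
Qed.

Lemma le_st_mu A C : alg M A -> alg M C -> ext A `<=` ext C ->
  st (mu M A) <= st (mu M C).
Proof.
by move=> MA MC AC; apply: le_st; [exact: prob_unit..|exact: mu_le].
Qed.

Lemma Loeb_inner_ge A B : alg M A -> ext A `<=` B ->
  st (mu M A) <= Loeb_inner M B.
Proof.
move=> MA AB; apply: ub_le_sup; last by exists A.
exists (st (mu M (sample M))) => _ [C [MC _] <-].
exact: le_st_mu alg_full (alg_sample MC).
Qed.

Lemma Loeb_inner_le B r :
  (forall A, alg M A -> ext A `<=` B -> st (mu M A) <= r) ->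
  Loeb_inner M B <= r.
Proof.
move=> Br; apply: ge_sup; last by move=> _ [A [MA AB] <-]; exact: Br.
have [A MA A0] := alg_empty.
by exists (st (mu M A)), A => //; split; rewrite ?A0.
Qed.

Lemma Loeb_outer_le C B : alg M C -> B `<=` ext C ->
  Loeb_outer M B <= st (mu M C).
Proof.
move=> MC BC; apply: ge_inf; last by exists C.
have [Z MZ Z0] := alg_empty.
by exists (st (mu M Z)) => _ [A [MA _] <-]; apply: le_st_mu; rewrite ?Z0.
Qed.

Lemma Loeb_outer_nonempty B : B `<=` ext (sample M) ->
  [set st (mu M C) | C in [set C | alg M C /\ B `<=` ext C]] !=set0.
Proof.
move=> BO; exists (st (mu M (sample M))), (sample M) => //.
by split=> //; exact: alg_full.
Qed.

Lemma Loeb_outer_ge B r : B `<=` ext (sample M) ->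
  (forall C, alg M C -> B `<=` ext C -> r <= st (mu M C)) ->
  r <= Loeb_outer M B.
Proof.
move=> BO Br; apply: lb_le_inf; first exact: Loeb_outer_nonempty.
by move=> _ [C [MC BC] <-]; exact: Br.
Qed.

Lemma Loeb_outer_lt B r : B `<=` ext (sample M) -> Loeb_outer M B < r ->
  exists C, [/\ alg M C, B `<=` ext C & st (mu M C) < r].
Proof.
by move=> /Loeb_outer_nonempty/inf_lt H /H [_ [C [MC BC] <-] lt_r]; exists C.
Qed.

Lemma Loeb_inner_le_outer B : B `<=` ext (sample M) ->
  Loeb_inner M B <= Loeb_outer M B.
Proof.
move=> BO; apply: Loeb_outer_ge => // C MC BC.
by apply: Loeb_inner_le => A MA AB; apply: le_st_mu => // x /AB/BC.
Qed.

Lemma Loeb_alg A : alg M A ->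
  Loeb_measurable M (ext A) /\ Loeb_measure M (ext A) = st (mu M A).
Proof.
move=> MA; have AO := alg_sample MA.
have le_in := Loeb_inner_ge MA (@subset_refl _ _).
have le_out := Loeb_outer_le MA (@subset_refl _ _).
have le_io := Loeb_inner_le_outer AO.
have eqA : Loeb_inner M (ext A) = st (mu M A).
  by apply/le_anti; rewrite le_in (le_trans le_io).
by split=> //; split=> //; apply/le_anti; rewrite le_io /= eqA.
Qed.

End Loeb.

(** Approximating every set of [alg M] from inside and from outside by sets of
    [alg N] puts the inner and outer measures of [N] between those of [M],
    which coincide on Loeb measurable sets. *)
Lemma Loeb_extends_approx (R : realType) (E : nonstandard_extension R) (t : ty)
    (N M : internal_space E t) :
  internal_probability M -> internal_probability N ->
  sample M = sample N ->
  (forall e, 0 < e -> forall A, alg M A ->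
    (exists D, [/\ alg N D, ext D `<=` ext A &
       hle (mu M A) (hadd (mu N D) (hreal E e))]) /\
    (exists D, [/\ alg N D, ext A `<=` ext D &
       hle (mu N D) (hadd (mu M A) (hreal E e))])) ->
  Loeb_extends N M.
Proof.
move=> Mp Np MN approx B [BO B_meas].
have BN : B `<=` ext (sample N) by rewrite -MN.
have in_le : Loeb_inner M B <= Loeb_inner N B.
  apply: Loeb_inner_le => // A MA AB; apply/ler_addgt0Pr => e e0.
  have [[D [ND DA AD]] _] := approx _ e0 _ MA.
  apply: le_trans (st_leD (prob_unit Mp MA) (prob_unit Np ND) AD) _.
  by rewrite lerD2r; apply: Loeb_inner_ge => // x /DA/AB.
have out_le : Loeb_outer N B <= Loeb_outer M B.
  apply: Loeb_outer_ge => // C MC BC; apply/ler_addgt0Pr => e e0.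
  have [_ [D [ND CD DC]]] := approx _ e0 _ MC.
  apply: le_trans (st_leD (prob_unit Np ND) (prob_unit Mp MC) DC).
  by apply: Loeb_outer_le => // x /BC/CD.
have io := Loeb_inner_le_outer Np BN.
have eqB : Loeb_inner N B = Loeb_inner M B.
  by apply/le_anti; rewrite in_le B_meas (le_trans io).
by split=> //; split=> //; apply/le_anti; rewrite io /= eqB B_meas.
Qed.

(** * Internal Lebesgue spaces *)

Definition hunit (R : realType) (E : nonstandard_extension R) : E (tPow tR) :=
  hcc (hreal E 0) (hreal E 1).

Definition hmes01 (R : realType) (E : nonstandard_extension R) :
    E (tPow (tPow tR)) :=
  star E (tPow (tPow tR)) (@mes01 R).

Definition hlam (R : realType) (E : nonstandard_extension R)
    (A : E (tPow tR)) : E tR :=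
  app_dom E (hlebesgue E) A.

#[export] Hint Unfold hunit hmes01 hlam : star.

Section LebesgueSpace.
Variables (R : realType) (E : nonstandard_extension R).
Implicit Types (A : E (tPow tR)) (C : E (tPow (tPow tR))).

Definition lebesgue_space C : internal_space E tR :=
  InternalSpace (hunit E) (ext (hgen (hunit E) C)) (hlebesgue E).

Lemma hmes01_sub A : ext (hmes01 E) A -> ext A `<=` ext (hunit E).
Proof. by move: A; transfer => A []. Qed.

Lemma hgen_hmes01 C A : ext C `<=` ext (hmes01 E) ->
  ext (hgen (hunit E) C) A -> ext (hmes01 E) A.
Proof. by move: C A; transfer => C A CM; exact: gen_mes01 CM _. Qed.

Lemma lebesgue_space_probability C : ext C `<=` ext (hmes01 E) ->
  internal_probability (lebesgue_space C).
Proof.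
move=> CM; split.
- by apply: (generated_algebraE _).2 => A /CM/hmes01_sub.
- move=> A /(hgen_hmes01 CM); rewrite /mu /=; move: A; transfer => A A1.
  by split; [exact: lambda_ge0|exact: lambda_le1].
- rewrite /mu /=; transfer.
  have := @lambda_itv R 0 1 true false ler01; rewrite subr0; exact.
- move=> A B D /(hgen_hmes01 CM) A1 /(hgen_hmes01 CM) B1 _ AB DE.
  have {AB}: forall x, ~ (ext A x /\ ext B x).
    by move=> x ABx; have : (ext A `&` ext B) x by []; rewrite AB.
  have {DE}: forall x, ext D x <-> ext A x \/ ext B x by rewrite DE.
  rewrite /mu /=; move: A1 B1; clear; move: A B D; transfer.
  move=> A B D A1 B1 DE AB.
  have -> : D = A `|` B by apply/seteqP; split=> x /DE.
  by apply: lambdaU => //; apply/seteqP; split=> x // /AB.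
Qed.

End LebesgueSpace.

(** * The two spaces for nonstandard cut points *)

Definition hcutF (R : realType) (E : nonstandard_extension R) (a b : E tR) :
    E (tPow (tPow tR)) :=
  lift2 (t := tPow (tPow tR)) (@cutF R) a b.

Definition hcutG (R : realType) (E : nonstandard_extension R) (a b : E tR) :
    E (tPow (tPow tR)) :=
  lift2 (t := tPow (tPow tR)) (@cutG R) a b.

#[export] Hint Unfold hcutF hcutG : star.

Section NonstandardCut.
Variables (R : realType) (E : nonstandard_extension R).
Implicit Types (a b x : E tR) (A : E (tPow tR)).
Local Notation zero := (hreal E 0).
Local Notation half := (hreal E 2^-1).
Local Notation one := (hreal E 1).

Lemma hcutFE a b : ext (hcutF a b) =
  [set A | [\/ A = hco zero half, A = hcc half one
             | exists2 x, ext (hcc a b) x & A = hset1 x]].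
Proof.
have FP A : ext (hcutF a b) A <-> A = hco zero half \/ A = hcc half one \/
    exists x, ext (hcc a b) x /\ A = hset1 x.
  move: a b A; transfer => a b A.
  split=> [[->|->|[x xab ->]]|[->|[->|[x [xab ->]]]]].
  - by left.
  - by right; left.
  - by right; right; exists x.
  - exact: Or31.
  - exact: Or32.
  - by apply: Or33; exists x.
apply/seteqP; split=> A.
- move=> /FP [->|[->|[x [xab ->]]]]; [exact: Or31|exact: Or32|].
  by apply: Or33; exists x.
- by move=> H; apply/FP; case: H => [->|->|[x xab ->]];
    [left|right; left|right; right; exists x].
Qed.

Lemma hcutGE a b : ext (hcutG a b) =
  [set A | [\/ A = hco zero a, A = hcc a b | A = hoc b one]].
Proof.
have GP A : ext (hcutG a b) A <->
    A = hco zero a \/ A = hcc a b \/ A = hoc b one.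
  move: a b A; transfer => a b A.
  by split=> [[->|->|->]|[->|[->| ->]]];
   [left|right; left|right; right|exact: Or31|exact: Or32|exact: Or33].
apply/seteqP; split=> A.
- by move=> /GP [->|[->|->]]; [exact: Or31|exact: Or32|exact: Or33].
- by move=> H; apply/GP; case: H => ->; [left|right; left|right; right].
Qed.

Lemma hcutF_hmes01 a b :
  hle zero a -> hlt a half -> hlt half b -> hle b one ->
  ext (hcutF a b) `<=` ext (hmes01 E).
Proof. by move: a b; transfer; exact: cutF_mes01. Qed.

Lemma hcutG_hmes01 a b :
  hle zero a -> hlt a half -> hlt half b -> hle b one ->
  ext (hcutG a b) `<=` ext (hmes01 E).
Proof. by move: a b; transfer; exact: cutG_mes01. Qed.

Lemma cutG_hyperfinite a b :
  hle zero a -> hlt a half -> hlt half b -> hle b one ->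
  hyperfinite_probability (lebesgue_space (hcutG a b)).
Proof.
move=> a0 ah hb b1; split.
  exact/lebesgue_space_probability/hcutG_hmes01.
exists (hgen (hunit E) (hcutG a b)) => //.
by move: a b a0 ah hb b1; transfer; exact: cutG_finite.
Qed.

Lemma cutG_Loeb_extends a b :
  hle zero a -> hlt a half -> hlt half b -> hle b one ->
  (forall e, 0 < e -> hle b (hadd a (hreal E e))) ->
  Loeb_extends (lebesgue_space (hcutG a b)) (lebesgue_space (hcutF a b)).
Proof.
move=> a0 ah hb b1 ab; apply: Loeb_extends_approx => //.
- exact/lebesgue_space_probability/hcutF_hmes01.
- exact/lebesgue_space_probability/hcutG_hmes01.
move=> e e0 A FA.
suff [[D [GD [DA AD]]] [D' [GD' [AD' DA']]]] :
  (exists D, ext (hgen (hunit E) (hcutG a b)) D /\ ext D `<=` ext A /\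
      hle (hlam A) (hadd (hlam D) (hreal E e))) /\
  (exists D, ext (hgen (hunit E) (hcutG a b)) D /\ ext A `<=` ext D /\
      hle (hlam D) (hadd (hlam A) (hreal E e))).
  by split; [exists D|exists D'].
move: a b a0 ah hb b1 {ab} (ab e e0) A FA.
transfer => a b a0 ah hb b1 ab A FA.
have [[D GD [DA AD]] [D' GD' [AD' DA']]] := cutF_approx a0 ah hb b1 FA.
have abe : b - a <= e by rewrite lerBlDl.
split; [exists D|exists D']; split=> //; split=> //.
- by apply: le_trans AD _; rewrite lerD2l.
- by apply: le_trans DA' _; rewrite lerD2l.
Qed.

Lemma hcutF_finite_or_half a b A :
  hle zero a -> hlt a half -> hlt half b -> hle b one ->
  ext (hgen (hunit E) (hcutF a b)) A -> hfinite A \/ hle half (hlam A).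
Proof. by move: a b A; transfer => a b A; exact: cutF_finite_or_half. Qed.

Lemma hcutF_singleton a b x : ext (hcc a b) x ->
  ext (hgen (hunit E) (hcutF a b)) (hset1 x) /\
  ext (hset1 x) x /\ hlam (hset1 x) = zero.
Proof.
move: a b x; transfer => a b x xab; split; [|split=> //].
- by apply: gen_incl; apply: Or33; exists x.
- exact/lambda_finite/finite_set1.
Qed.

(** Transfer of the fact that a finite union of finite sets is finite, whereas
    a nondegenerate interval is not. *)
Lemma hcc_not_covered a b (H : E (tPow (tPow tR))) : hlt a b -> hfinite H ->
  ~ (forall x, ext (hcc a b) x ->
       exists C, ext H C /\ hfinite C /\ ext C x).
Proof.
move: a b H; transfer => a b H ab Hfin cover.
have : finite_set (\bigcup_(C in H `&` [set C | finite_set C]) C).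
  by apply: bigcup_finite => [|C []//]; exact: finite_setIl.
move=> fin_cover.
have : lambda `[a, b]%classic = 0.
  apply/lambda_finite/(sub_finite_set _ fin_cover) => x /cover [C [HC [Cfin Cx]]].
  by exists C.
by rewrite lambda_itv ?ltW//; lra.
Qed.

Lemma cutF_not_Loeb_equivalent a b (X : internal_space E tR) :
  hle zero a -> hlt a half -> hlt half b -> hle b one ->
  hyperfinite_probability X ->
  ~ Loeb_equivalent (lebesgue_space (hcutF a b)) X.
Proof.
move=> a0 ah hb b1 [X_prob [H HX H_fin]] [meas_eq mu_eq].
have M_prob : internal_probability (lebesgue_space (hcutF a b)).
  exact/lebesgue_space_probability/hcutF_hmes01.
have lt_ab : hlt a b.
  move: a b ah hb {a0 b1 meas_eq mu_eq M_prob}.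
  by transfer=> a b; exact: lt_trans.
apply: (hcc_not_covered lt_ab H_fin) => x /hcutF_singleton [Fx [xx x0]].
have [Mx mux] := Loeb_alg M_prob Fx.
have Xx := (meas_eq _).1 Mx.
have x_small : Loeb_outer X (ext (hset1 x)) < 2^-1.
  rewrite -Xx.2 -[Loeb_inner _ _]/(Loeb_measure X _) -mu_eq// mux.
  by rewrite /mu /= -/(hlam _) x0 st_hreal.
have [C [XC xC C_small]] := Loeb_outer_lt X_prob Xx.1 x_small.
exists C; rewrite HX; split=> //; split; last exact: xC.
have [CX CXmu] := Loeb_alg X_prob XC; have CM := (meas_eq _).2 CX.
have : Loeb_outer (lebesgue_space (hcutF a b)) (ext C) < 2^-1.
  by rewrite -CM.2 -[Loeb_inner _ _]/(Loeb_measure _ _) mu_eq// CXmu.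
move=> /(Loeb_outer_lt M_prob CM.1) [D [FD CD D_small]].
have [D_fin|D_big] := hcutF_finite_or_half a0 ah hb b1 FD.
  move: D_fin CD; clear; move: C D; transfer => C D + CD.
  exact: sub_finite_set.
move: D_small; rewrite ltNge => /negP[].
rewrite -[leLHS](st_hreal E); apply: le_st => //; last exact: prob_unit FD.
by split; transfer; lra.
Qed.

End NonstandardCut.

(** * Infinite hypernatural numbers *)

Section InfiniteN.
Variables (R : realType) (E : nonstandard_extension R) (N : E tR).
Hypothesis N_infinite : infinite_hnat N.
Let a := hsub (hreal E 2^-1) (hinv N).
Let b := hadd (hreal E 2^-1) (hinv N).

(** Induction on the standard number m: by transfer no hypernatural number lies
    strictly between m and m + 1. *)
Lemma infinite_ge (m : nat) : hle (hreal E m%:R) N.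
Proof.
case: N_infinite => N_nat N_inf; elim: m => [|m IH].
  by move: N_nat; clear; move: N; transfer => _ [k _ <-].
have gap (n : E tR) : hnat n -> hle (hreal E m%:R) n ->
    n = hreal E m%:R \/ hle (hreal E m.+1%:R) n.
  move: n; transfer=> _ [k _ <-]; rewrite !ler_nat leq_eqVlt.
  by case/predU1P => [->|]; [left|right].
by case: (gap N N_nat IH) => // /N_inf.
Qed.

Lemma infinite_cut : [/\ hle (hreal E 0) a, hlt a (hreal E 2^-1),
  hlt (hreal E 2^-1) b & hle b (hreal E 1)].
Proof.
suff [a0 [ah [hb b1]]] : hle (hreal E 0) a /\ hlt a (hreal E 2^-1) /\
   hlt (hreal E 2^-1) b /\ hle b (hreal E 1) by [].
have := infinite_ge 2; rewrite /a /b; clear; move: N; transfer => n n2.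
have n0 : 0 < n by lra.
have n1 : n^-1 <= 2^-1 by rewrite lef_pV2// posrE.
have n3 : 0 < n^-1 by rewrite invr_gt0.
by split; [|split; [|split]]; lra.
Qed.

Lemma infinite_cut_close e : 0 < e -> hle b (hadd a (hreal E e)).
Proof.
move=> e0; pose m := Num.bound (2 / e).
have e2 : 0 < 2 / e by rewrite divr_gt0.
have me : 2 / e <= m%:R by apply/ltW/archi_boundP/ltW.
have := infinite_ge m; rewrite /a /b; move: me; clear -e0 e2.
move: m => m me; move: N; transfer => n mn.
have ne : 2 / e <= n by apply: le_trans mn.
have n0 : 0 < n by apply: lt_le_trans ne.
have : 2 * n^-1 <= e by rewrite ler_pdivrMr// mulrC -ler_pdivrMr.
lra.
Qed.

End InfiniteN.

Unset Implicit Arguments.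

Theorem mainTheorem2 (R : realType) (E : nonstandard_extension R)
    (N : E tR) (N_infinite : infinite_hnat N) :
  let zero := hreal E 0 in
  let half := hreal E 2^-1 in
  let one := hreal E 1 in
  let a := hsub half (hinv N) in
  let b := hadd half (hinv N) in
  let Om := hcc zero one in
  let F := generated_algebra Om
    [set A | [\/ A = hco zero half, A = hcc half one
               | exists2 x, ext (hcc a b) x & A = hset1 x]] in
  let G := generated_algebra Om
    [set A | [\/ A = hco zero a, A = hcc a b | A = hoc b one]] in
  let MM := InternalSpace Om F (hlebesgue E) in
  let NN := InternalSpace Om G (hlebesgue E) in
  [/\ internal_probability MM,
      hyperfinite_probability NN,
      Loeb_extends NN MM &
      forall (G' : set (E (tPow tR))) (P : E (tFun (tPow tR) tR)),
        hyperfinite_probability (InternalSpace Om G' P) ->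
        ~ Loeb_equivalent MM (InternalSpace Om G' P)].
Proof.
move=> zero half one a b Om F G MM NN.
have [a0 ah hb b1] := infinite_cut N_infinite.
have FM := hcutF_hmes01 a0 ah hb b1.
have GM := hcutG_hmes01 a0 ah hb b1.
have ME : MM = lebesgue_space (hcutF a b).
  by rewrite /MM /F -hcutFE (generated_algebraE _).1// => A /FM/hmes01_sub.
have NE : NN = lebesgue_space (hcutG a b).
  by rewrite /NN /G -hcutGE (generated_algebraE _).1// => A /GM/hmes01_sub.
rewrite ME NE; split.
- exact: lebesgue_space_probability.
- exact: cutG_hyperfinite.
- by apply: cutG_Loeb_extends => // e; exact: infinite_cut_close.
- by move=> G' P; exact: cutF_not_Loeb_equivalent.
Qed.
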